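(* Let $n\ge 1$ and let $P,Q\in\mathbb C[X_1,\ldots,X_n]$ be such that $\mathcal Z_P=\mathcal Z_Q$. Then $P$ is of type A if and only if $Q$ is of type A.
   Context: $\mathbb C[X_1,\ldots,X_n]$ is regarded as a $*$-algebra with involution $(R+\mathrm iS)^*=R-\mathrm iS$ for $R,S\in\mathbb R[X_1,\ldots,X_n]$ (so $X_j^*=X_j$). For $P\in\mathbb C[X_1,\ldots,X_n]$, let $\mathcal Z_P=\{x\in\mathbb R^n: P(x)=0\}$ (real zeros only) and let $(P)_{\mathsf c}$ be the ideal of $\mathbb C[X_1,\ldots,X_n]$ generated by $P$. A complex linear functional $\Lambda:\mathbb C[X_1,\ldots,X_n]\to\mathbb C$ is positive definite if $\Lambda(R^*R)\ge0$ for all $R\in\mathbb C[X_1,\ldots,X_n]$. It is a moment functional if there is a positive Borel measure $\mu$ on $\mathbb R^n$, with respect to which all polynomials are absolutely integrable, such that $\Lambda(R)=\int_{\mathbb R^n}R\,d\mu$ for all $R\in\mathbb C[X_1,\ldots,X_n]$. A polynomial $P\in\mathbb C[X_1,\ldots,X_n]$ is of type A if every positive definite complex linear functional on $\mathbb C[X_1,\ldots,X_n]$ vanishing on $(P)_{\mathsf c}$ is a moment functional. *)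

(* Defs.v *)
From HB Require Import structures.
From mathcomp Require Import all_boot all_order all_algebra.
From mathcomp Require Import complex mpoly.
From mathcomp Require Import all_classical all_reals all_analysis.
Import Order.TTheory GRing.Theory Num.Theory.
Import numFieldNormedType.Exports.

Set Implicit Arguments.
Unset Strict Implicit.
Unset Printing Implicit Defensive.

Local Open Scope classical_set_scope.
Local Open Scope complex_scope.
Local Open Scope ring_scope.

Definition evalR (R : realType) (n : nat) (P : {mpoly R[i][n]})
  (x : 'rV[R]_n) : R[i] := P.@[fun i => (x ord0 i)%:C].

Definition real_zeros (R : realType) (n : nat) (P : {mpoly R[i][n]}) :
  set 'rV[R]_n := [set x | evalR P x = 0].

(* (A + iB)^* = A - iB for real A and B, that is, the conjugation of the
   coefficients; the indeterminates are fixed. *)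
Definition mpoly_star (R : realType) (n : nat) (P : {mpoly R[i][n]}) :
  {mpoly R[i][n]} := map_mpoly (@conjc R) P.

Definition principal_ideal (R : realType) (n : nat) (P : {mpoly R[i][n]}) :
  set {mpoly R[i][n]} := [set S * P | S in setT].

(* In R[i], 0 <= z means that z is real and nonnegative. *)
Definition positive_definite (R : realType) (n : nat)
  (L : {scalar {mpoly R[i][n]}}) : Prop :=
  forall S : {mpoly R[i][n]}, 0 <= L (mpoly_star S * S).

Notation borel_rV R n := (g_sigma_algebraType (@open 'rV[R]_n)).

Definition cintegrable d (T : measurableType d) (R : realType)
  (mu : {measure set T -> \bar R}) (f : T -> R[i]) : Prop :=
  mu.-integrable setT (fun x => (ComplexField.Normc.normc (f x))%:E).

Definition cintegral d (T : measurableType d) (R : realType)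
  (mu : {measure set T -> \bar R}) (f : T -> R[i]) : R[i] :=
  (\int[mu]_x complex.Re (f x)) +i* (\int[mu]_x complex.Im (f x)).

Definition moment_functional (R : realType) (n : nat)
  (L : {scalar {mpoly R[i][n]}}) : Prop :=
  exists mu : {measure set (borel_rV R n) -> \bar R},
    (forall S : {mpoly R[i][n]}, cintegrable mu (evalR S)) /\
    (forall S : {mpoly R[i][n]}, L S = cintegral mu (evalR S)).

Definition type_A (R : realType) (n : nat) (P : {mpoly R[i][n]}) : Prop :=
  forall L : {scalar {mpoly R[i][n]}},
    positive_definite L ->
    (forall S, principal_ideal P S -> L S = 0) ->
    moment_functional L.

(* Main.v *)
(* Let L be positive definite and vanish on (P).  The real polynomials a with
   L(a^2) = 0 form an ideal I which is real: by Cauchy-Schwarz, L(a^2) = 0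
   forces L(b a) = 0 for all b.  If Q vanishes on the real zeros of P then the
   real Nullstellensatz, applied to |P|^2 and |Q|^2, gives
   |Q|^(2m) + (sum of squares) in (|P|^2); so a power of |Q|^2 lies in I, hence
   |Q|^2 does, and L vanishes on (Q).  Thus P and Q are annihilated by the same
   positive definite functionals.

   For the Nullstellensatz, if no such identity exists then Zorn's lemma extends
   the cone of sums of squares plus (p) to an ordering of a residue domain of
   R[X] in which p = 0 and q <> 0.  A countable subring carrying p and q embeds,
   with its order, in a real closed field K: a maximal ordered subfield of an
   algebraic closure (countability is what the available construction of the
   algebraic closure requires).  Quantifier elimination moves the resulting
   K-point with p = 0 and q <> 0 back to R. *)

From HB Require Import structures.
Require Import Defs.
From mathcomp Require Import all_boot all_order all_algebra.
From mathcomp Require Import complex mpoly.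
From mathcomp Require Import all_classical all_reals all_analysis.
From mathcomp Require Import ring lra zify.
From mathcomp Require Import closed_field.
From mathcomp Require qe_rcf_th qe_rcf.
Import Order.TTheory GRing.Theory Num.Theory.
Import numFieldNormedType.Exports.

Local Open Scope classical_set_scope.
Local Open Scope ring_scope.

Set Implicit Arguments.
Unset Strict Implicit.
Unset Printing Implicit Defensive.

(** * Orderings of commutative rings *)

(** [Zorn_bigcup] is applied to the sets [B] such that [A0] joined with [B] satisfies [P]. The empty
    chain then causes no trouble: its union is empty, which leaves [A0] itself. *)
Lemma zorn_above (T : Type) (P : set (set T)) (A0 : set T) :
    P A0 ->
    (forall F : set (set T), F !=set0 -> F `<=` P -> total_on F subset ->
       P (\bigcup_(X in F) X)) ->
  exists A, [/\ A0 `<=` A, P A & forall B, A `<=` B -> P B -> B = A].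
Proof.
move=> PA0 PU.
have [F FP Ftot|B [PB maxB]] := @Zorn_bigcup T [set B | P (A0 `|` B)].
  rewrite /=; have [->|/set0P F0] := eqVneq F set0.
    by rewrite bigcup_set0 setU0.
  rewrite (_ : A0 `|` _ = \bigcup_(X in [set A0 `|` Y | Y in F]) X); last first.
    rewrite bigcup_image predeqE => x; split=> [[A0x|[X FX Xx]]|[X FX [A0x|Xx]]].
    - by have [X FX] := F0; exists X => //; left.
    - by exists X => //; right.
    - by left.
    - by right; exists X.
  apply: PU.
  - by have [X FX] := F0; exists (A0 `|` X), X.
  - by move=> _ [X FX <-]; exact: FP.
  - move=> _ _ [X FX <-] [Y FY <-].
    by have [XY|YX] := Ftot _ _ FX FY; [left|right]; exact: setUS.
exists (A0 `|` B); split=> //.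
move=> X sBX PX; apply: contrapT => neqX; apply: (maxB X).
  rewrite properEneq; split; last by apply: subset_trans sBX => x; right.
  apply/eqP => BX; apply: neqX; rewrite -BX in sBX *.
  by apply/seteqP; split=> // x; right.
by rewrite /= (setUidr _) //; apply: subset_trans sBX => x; left.
Qed.

Section PrimeCone.
Variable A : comNzRingType.
Implicit Types (T : set A) (x y : A).

Definition precone T : Prop :=
  [/\ forall x y, T x -> T y -> T (x + y),
      forall x y, T x -> T y -> T (x * y)
    & forall x, T (x * x)].

Definition support T : set A := [set x | T x /\ T (- x)].

(** A point of the real spectrum of [A]: the support is a prime ideal and the cone orders the
    residue domain. *)
Definition prime_cone T : Prop :=
  [/\ precone T, ~ T (-1), forall x, T x \/ T (- x)
    & forall x y, support T (x * y) -> support T x \/ support T y].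

Lemma precone_adjoin T a : precone T ->
  precone [set x | exists s t, [/\ T s, T t & x = s + a * t]].
Proof.
move=> [TD TM TX]; split=> [x y|x y|x].
- move=> [s [t [Ts Tt ->]]] [s' [t' [Ts' Tt' ->]]].
  by exists (s + s'), (t + t'); split; [exact: TD|exact: TD|ring].
(* The term in [t * t'] carries the square [a * a], which lies in the precone and can be absorbed
   into the constant part. *)
- move=> [s [t [Ts Tt ->]]] [s' [t' [Ts' Tt' ->]]].
  exists (s * s' + (a * a) * (t * t')), (s * t' + s' * t).
  split; [|by apply: TD; apply: TM|by ring].
  by apply: TD; apply: (TM) => //; exact: TM.
- by exists (x * x), (0 * 0); split=> //; ring.
Qed.

(** A precone maximal among those containing no [- (q ^+ m) ^+ 2] is already an ordering. Adjoining
    a missing element produces such a negative square, and multiplying two identities of this kind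
    refutes a failure of totality or of primality of the support. *)
Lemma prime_cone_above T0 q : precone T0 -> (forall m, ~ T0 (- (q ^+ m) ^+ 2)) ->
  exists T, [/\ T0 `<=` T, prime_cone T & ~ support T q].
Proof.
move=> cT0 qT0.
pose P := [set T | precone T /\ forall m, ~ T (- (q ^+ m) ^+ 2)].
have [//||T [T0T [cT qT] maxT]] := @zorn_above A P T0.
  move=> F [X0 FX0] FP Ftot; split; first split.
  - move=> x y [X FX Xx] [Y FY Yy].
    by have [XY|YX] := Ftot _ _ FX FY; [exists Y|exists X] => //;
       [have [[+ _ _] _] := FP _ FY|have [[+ _ _] _] := FP _ FX]; apply; auto.
  - move=> x y [X FX Xx] [Y FY Yy].
    by have [XY|YX] := Ftot _ _ FX FY; [exists Y|exists X] => //;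
       [have [[_ + _] _] := FP _ FY|have [[_ + _] _] := FP _ FX]; apply; auto.
  - by move=> x; exists X0 => //; have [[_ _ +] _] := FP _ FX0; apply.
  - by move=> m [X FX]; have [_ +] := FP _ FX; apply.
have [TD TM TX] := cT.
have T0' : T 0 by have := TX 0; rewrite mulr0.
have T1 : T 1 by have := TX 1; rewrite mulr1.
have adj a : ~ T a -> exists m s t, [/\ T s, T t & - (q ^+ m) ^+ 2 = s + a * t].
  move=> nTa; apply: contrapT => nex; apply: nTa.
  rewrite -(maxT [set x | exists s t, [/\ T s, T t & x = s + a * t]]).
  - by exists 0, 1; split=> //; ring.
  - by move=> x Tx; exists x, 0; split=> //; ring.
  - split; first exact: precone_adjoin.
    by move=> m [s [t [Ts Tt e]]]; apply: nex; exists m, s, t.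
have Ttot x : T x \/ T (- x).
  apply: contrapT => /not_orP [/adj[m [s [t [Ts Tt e]]]]].
  move=> /adj[m' [s' [t' [Ts' Tt' e']]]].
  apply: (qT (m + m')%N).
  (* The two identities give [x * t] and [- x * t'] as negatives of elements of the form
     [(q ^+ k) ^+ 2 + s]. Their product expresses the forbidden element inside [T]. *)
  rewrite (_ : - _ = s * (q ^+ m') ^+ 2 + s' * (q ^+ m) ^+ 2 + s * s'
                     + (x * x) * (t * t')); last first.
    have -> : x * x * (t * t') = - (x * t) * (- x * t') by ring.
    have -> : x * t = - (q ^+ m) ^+ 2 - s by rewrite e; ring.
    have -> : - x * t' = - (q ^+ m') ^+ 2 - s' by rewrite e'; ring.
    by rewrite exprD; ring.
  by rewrite !expr2; do ?[exact: TX | done | apply: (TD) | apply: (TM)].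
have sM x y : support T x -> support T (x * y).
  move=> [Tx TNx]; have [Ty|TNy] := Ttot y; split; rewrite -?mulNr; try exact: TM.
  - by rewrite -mulrNN; exact: TM.
  - by rewrite mulNr -mulrN; exact: TM.
(* Whichever of [x] and [- x] is missing, the sign goes into the cofactor [t], which need not belong
   to [T]. This is harmless below, since the support absorbs arbitrary factors. *)
have nsup x : ~ support T x -> exists m s t, T s /\ (q ^+ m) ^+ 2 + s = x * t.
  have step y : ~ T y -> exists m s t, T s /\ (q ^+ m) ^+ 2 + s = - y * t.
    move=> /adj[m [s [t [Ts Tt e]]]]; exists m, s, t; split=> //.
    by rewrite -[_ ^+ 2]opprK e; ring.
  move=> /not_andP [/step [m [s [t [Ts e]]]]|/step [m [s [t [Ts e]]]]].
  - by exists m, s, (- t); split=> //; rewrite e; ring.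
  - by exists m, s, t; split=> //; rewrite e; ring.
exists T; split=> //; first split=> //.
- by have := qT 0%N; rewrite expr0 expr1n.
- move=> x y sxy; apply: contrapT => /not_orP[/nsup[m [s [t [Ts e]]]]].
  move=> /nsup[m' [s' [t' [Ts' e']]]].
  have := sM _ (t * t') sxy => -[_ TN]; apply: (qT (m + m')%N).
  rewrite (_ : - _ = s * (q ^+ m') ^+ 2 + s' * (q ^+ m) ^+ 2 + s * s'
                     - x * y * (t * t')); last first.
    have -> : x * y * (t * t') = x * t * (y * t') by ring.
    by rewrite -e -e' exprD; ring.
  by rewrite !expr2; do ?[exact: TX | done | apply: (TD) | apply: (TM)].
- by move=> /(sM _ q)[_ ?]; apply: (qT 1%N); rewrite expr1 expr2.
Qed.

Lemma prime_cone_supp0 T : prime_cone T -> support T 0.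
Proof. by move=> [[_ _ TX] _ _ _]; split; rewrite ?oppr0 -(mulr0 0). Qed.

Lemma prime_cone_suppM T x y : prime_cone T -> support T x -> support T (x * y).
Proof.
move=> [[_ TM _] _ Ttot _] [Tx TNx]; have [Ty|TNy] := Ttot y.
  by split; rewrite -?mulNr; exact: TM.
by split; [rewrite -mulrNN|rewrite -mulrN]; exact: TM.
Qed.

Lemma prime_cone_suppD T x y : prime_cone T ->
  support T x -> support T y -> support T (x + y).
Proof.
by move=> [[TD _ _] _ _ _] [Tx TNx] [Ty TNy]; split; rewrite ?opprD; exact: TD.
Qed.

Lemma prime_cone_supp1 T : prime_cone T -> ~ support T 1.
Proof. by move=> [_ TN1 _ _] [_]. Qed.

End PrimeCone.

(** * Sums of squares with weights *)

Section WeightedSquares.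
Variables (A : comNzRingType) (N : set A).

Inductive wsos : A -> Prop :=
| Wsos0 : wsos 0
| WsosD s c f : wsos s -> N c -> wsos (s + c * f ^+ 2).

Lemma wsos_add s t : wsos s -> wsos t -> wsos (s + t).
Proof.
move=> ss; elim=> [|{}t c f _ IH Nc]; first by rewrite addr0.
by rewrite addrA; exact: WsosD.
Qed.

Lemma wsos_sqr c f : N c -> wsos (c * f ^+ 2).
Proof. by move=> Nc; rewrite -[_ * _]add0r; apply: WsosD => //; exact: Wsos0. Qed.

Lemma wsos_mulsqr s c f : (forall c d, N c -> N d -> N (c * d)) ->
  wsos s -> N c -> wsos (s * (c * f ^+ 2)).
Proof.
move=> NM + Nc; elim=> [|{}s d g _ IH Nd]; first by rewrite mul0r; exact: Wsos0.
rewrite mulrDl (_ : d * _ * _ = d * c * (g * f) ^+ 2); last by ring.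
by apply: WsosD => //; exact: NM.
Qed.

Lemma wsos_mul s t : (forall c d, N c -> N d -> N (c * d)) ->
  wsos s -> wsos t -> wsos (s * t).
Proof.
move=> NM ss; elim=> [|{}t c f _ IH Nc]; first by rewrite mulr0; exact: Wsos0.
by rewrite mulrDr; apply: wsos_add => //; exact: wsos_mulsqr.
Qed.

Lemma precone_wsos g : N 1 -> (forall c d, N c -> N d -> N (c * d)) ->
  precone [set x | exists s h, wsos s /\ x = s + h * g].
Proof.
move=> N1 NM; split=> [x y|x y|x].
- move=> [s [h [ss ->]]] [s' [h' [ss' ->]]]; exists (s + s'), (h + h').
  by split; [exact: wsos_add|ring].
- move=> [s [h [ss ->]]] [s' [h' [ss' ->]]].
  exists (s * s'), (s * h' + s' * h + h * g * h').
  by split; [exact: wsos_mul|ring].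
- exists (1 * x ^+ 2), 0; split; last by ring.
  exact: wsos_sqr.
Qed.

End WeightedSquares.

(** * Real closed fields from orderings *)

(** The nonnegative elements of an ordered subfield of [C]. The subfield consists of the cone and
    its opposite, so one subset carries both the subfield and its order, and extension of ordered
    subfields becomes inclusion of cones. *)
Record field_cone (C : fieldType) := FieldCone {
  cone_set :> C -> Prop;
  cone1 : cone_set 1;
  coneD : forall x y, cone_set x -> cone_set y -> cone_set (x + y);
  coneM : forall x y, cone_set x -> cone_set y -> cone_set (x * y);
  coneV : forall x, cone_set x -> cone_set x^-1;
  cone_anti : forall x, cone_set x -> cone_set (- x) -> x = 0;
  cone_total : forall x y, cone_set x -> cone_set y ->
    cone_set (x - y) \/ cone_set (y - x) }.

Section ConeField.
Variables (C : fieldType) (P : field_cone C).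

Definition cone_dom : {pred C} := fun x => `[< P x \/ P (- x) >].

Lemma cone_domP x : reflect (P x \/ P (- x)) (x \in cone_dom).
Proof. exact: asboolP. Qed.

Lemma cone_dom_divring : divring_closed cone_dom.
Proof.
split; first by apply/cone_domP; left; exact: cone1.
- move=> x y /cone_domP Dx /cone_domP Dy; apply/cone_domP; rewrite opprB.
  case: Dx Dy => [Px|Px] [Py|Py]; first exact: cone_total.
  + by left; exact: coneD.
  + by right; exact: coneD.
  + have := cone_total Py Px.
    by rewrite !opprK [- y + x]addrC [- x + y]addrC.
- move=> x y /cone_domP Dx /cone_domP Dy; apply/cone_domP.
  rewrite -mulrN; case: Dx Dy => [Px|Px] [/coneV Py|/coneV Py].
  + by left; exact: coneM.
  + by right; apply: coneM => //; rewrite -invrN.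
  + by right; rewrite mulrN -mulNr; exact: coneM.
  + by left; rewrite -mulrNN -invrN; exact: coneM.
Qed.

HB.instance Definition _ := GRing.isDivringClosed.Build C cone_dom
  cone_dom_divring.

Record cone_field := ConeField { cone_val :> C; _ : cone_val \in cone_dom }.

HB.instance Definition _ := [isSub for cone_val].
HB.instance Definition _ := [Choice of cone_field by <:].
HB.instance Definition _ := [SubChoice_isSubUnitRing of cone_field by <:].
HB.instance Definition _ := [SubNzRing_isSubComNzRing of cone_field by <:].
HB.instance Definition _ :=
  [SubComUnitRing_isSubIntegralDomain of cone_field by <:].
HB.instance Definition _ := [SubIntegralDomain_isSubField of cone_field by <:].

Implicit Types x y : cone_field.

Definition cone_le x y := `[< P (val y - val x) >].
Definition cone_lt x y := (y != x) && cone_le x y.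
Definition cone_norm x := if cone_le 0 x then x else - x.

Lemma cone_le0 x : cone_le 0 x = `[< P (val x) >].
Proof. by rewrite /cone_le rmorph0 subr0. Qed.

Lemma cone_leN0 x : cone_le x 0 = `[< P (- val x) >].
Proof. by rewrite /cone_le rmorph0 sub0r. Qed.

Fact cone_le0_add x y : cone_le 0 x -> cone_le 0 y -> cone_le 0 (x + y).
Proof.
by rewrite !cone_le0 rmorphD => /asboolP ? /asboolP ?; apply/asboolP/coneD.
Qed.

Fact cone_le0_mul x y : cone_le 0 x -> cone_le 0 y -> cone_le 0 (x * y).
Proof.
by rewrite !cone_le0 rmorphM => /asboolP ? /asboolP ?; apply/asboolP/coneM.
Qed.

Fact cone_le0_anti x : cone_le 0 x -> cone_le x 0 -> x = 0.
Proof.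
rewrite cone_le0 cone_leN0 => /asboolP Px /asboolP PNx.
by apply: val_inj; rewrite rmorph0; exact: (cone_anti Px PNx).
Qed.

Fact cone_sub_ge0 x y : cone_le 0 (y - x) = cone_le x y.
Proof. by rewrite cone_le0 rmorphB. Qed.

Fact cone_le0_total x : cone_le 0 x || cone_le x 0.
Proof.
rewrite cone_le0 cone_leN0; case: x => x /= /cone_domP[Px|Px].
  by apply/orP; left; apply/asboolP.
by apply/orP; right; apply/asboolP.
Qed.

Fact cone_normN x : cone_norm (- x) = cone_norm x.
Proof.
rewrite /cone_norm opprK; have leN : cone_le 0 (- x) = cone_le x 0.
  by rewrite -(cone_sub_ge0 x 0) sub0r.
rewrite leN; have := cone_le0_total x.
case: ifP; case: ifP => // h1 h2 _.
by rewrite (cone_le0_anti h1 h2) oppr0.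
Qed.

Fact cone_ge0_norm x : cone_le 0 x -> cone_norm x = x.
Proof. by rewrite /cone_norm => ->. Qed.

Fact cone_lt_def x y : cone_lt x y = (y != x) && cone_le x y.
Proof. by []. Qed.

HB.instance Definition _ := Num.IntegralDomain_isLeReal.Build cone_field
  cone_le0_add cone_le0_mul cone_le0_anti cone_sub_ge0 cone_le0_total
  cone_normN cone_ge0_norm cone_lt_def.

Lemma cone_ge0E (x : cone_field) : (0 <= x) <-> P (val x).
Proof. by rewrite /Order.le /= cone_le0; split=> /asboolP. Qed.

End ConeField.


(** * Polynomials that change sign over an ordered field *)

Section SignChange.
Variable F : realFieldType.
Implicit Types (p g s h : {poly F}) (a b : F).

Definition nneg_const : set {poly F} := [set c%:P | c in [set c | 0 <= c]].

Lemma nneg_const1 : nneg_const 1.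
Proof. by exists 1 => //; rewrite /= ler01. Qed.

Lemma nneg_constM c d : nneg_const c -> nneg_const d -> nneg_const (c * d).
Proof.
move=> [x /= x0 <-] [y /= y0 <-]; exists (x * y); last by rewrite polyCM.
by rewrite /= mulr_ge0.
Qed.

Lemma wsos_horner_ge0 s a : wsos nneg_const s -> 0 <= s.[a].
Proof.
elim=> [|{}s _ f _ IH [c /= c0 <-]]; first by rewrite horner0.
by rewrite hornerD hornerM hornerC horner_exp addr_ge0 // mulr_ge0 // sqr_ge0.
Qed.

(** Each [f] is replaced by its remainder [r], and [f ^+ 2 - r ^+ 2] factors through [f - r]. If [g]
    has degree d, the squares of remainders have degree at most 2d - 2; the bound 2d - 1 counts
    coefficients. *)
Lemma wsos_modp g s : g != 0 -> wsos nneg_const s ->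
  exists s', [/\ wsos nneg_const s', g %| s - s'
    & (size s' <= (size g).-1.*2.-1)%N].
Proof.
move=> g0; elim=> [|{}s _ f ss [s' [ss' gs' szs']] [c /= c0 <-]].
  by exists 0; rewrite subr0 dvdp0 size_poly0; split=> //; exact: Wsos0.
exists (s' + c%:P * (f %% g) ^+ 2); split.
- by apply: WsosD => //; exists c.
- rewrite (_ : _ - _ = (s - s') + c%:P * ((f + f %% g) * (f - f %% g))); last first.
    by ring.
  rewrite dvdp_add // !dvdp_mull //.
  by rewrite {1}(divp_eq f g) addrK dvdp_mull.
- rewrite (leq_trans (size_polyD _ _)) // geq_max szs' /=.
  rewrite mul_polyC (leq_trans (size_scale_leq _ _)) //.
  have [->|r0] := eqVneq (f %% g) 0; first by rewrite expr0n size_poly0.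
  have := ltn_modpN0 f g0; rewrite -size_poly_gt0 in r0.
  rewrite expr2 size_mul -?size_poly_gt0 //.
  by move: (size (f %% g)) (size g) r0 => u v; lia.
Qed.

(* If [-1] is a sum of squares modulo [g] then the squares can be reduced
   modulo [g]; the cofactor of [g] then has smaller degree and changes sign
   between the same points. *)
Lemma sign_change_not_wsos g a b s h : g.[a] * g.[b] < 0 ->
  wsos nneg_const s -> -1 <> s + h * g.
Proof.
have [n] := ubnP (size g); elim: n => // n IHn in g s h *.
rewrite ltnS => szg gab ss e.
have g0 : g != 0 by apply: contraTneq gab => ->; rewrite horner0 mul0r ltxx.
have sz1 : (1 < size g)%N.
  rewrite ltnNge; apply/negP => /size1_polyC gc.
  by move: gab; rewrite gc !hornerC -expr2 ltNge sqr_ge0.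
have [s' [ss' /dvdpP[k ek] szs']] := wsos_modp g0 ss.
have e' : 1 + s' = - (h + k) * g.
  by rewrite mulNr mulrDl -ek -[1]opprK e; ring.
set h' := - (h + k) in e'.
have pos c : 0 < h'.[c] * g.[c].
  by rewrite -hornerM -e' hornerD hornerC ltr_pwDl // wsos_horner_ge0.
have h'ab : h'.[a] * h'.[b] < 0.
  rewrite -(nmulr_rgt0 _ gab).
  have := mulr_gt0 (pos a) (pos b).
  by rewrite mulrACA [in X in _ < X]mulrC.
have h'0 : h' != 0 by apply: contraTneq h'ab => ->; rewrite horner0 mul0r ltxx.
(* The roles are exchanged: [h'] becomes the modulus and [- g] its cofactor. *)
apply: (IHn h' s' (- g)) => //.
  apply: leq_trans szg; have := size_mul h'0 g0; rewrite -e' => sz.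
  have : (size (1 + s')%R <= maxn 1 (size g).-1.*2.-1)%N.
    rewrite (leq_trans (size_polyD _ _)) // size_poly1 geq_max leq_maxl.
    by rewrite leq_max szs' orbT.
  rewrite sz; move: (size h') (size g) sz1 => u v; lia.
by rewrite mulNr mulrC -e'; ring.
Qed.

(** If both factors of a product had nonnegative products of values at [a] and [b], so would the
    product; hence a sign change passes to a factor of smaller degree. *)
Lemma sign_change_irreducible p a b : p.[a] * p.[b] < 0 ->
  exists g, [/\ irreducible_poly g, g %| p & g.[a] * g.[b] < 0].
Proof.
have [n] := ubnP (size p); elim: n => // n IHn in p *; rewrite ltnS => szp pab.
have p0 : p != 0 by apply: contraTneq pab => ->; rewrite horner0 mul0r ltxx.
have sz1 : (1 < size p)%N.
  rewrite ltnNge; apply/negP => /size1_polyC pc.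
  by move: pab; rewrite pc !hornerC -expr2 ltNge sqr_ge0.
have [pirr|] := pselect (irreducible_poly p); first by exists p; split.
move=> /not_andP[//|/existsNP[u /not_implyP[szu /not_implyP[up nup]]]].
have /dvdpP[v ev] := up.
have u0 : u != 0 by apply: contraNneq p0 => u0; rewrite ev u0 mulr0.
have v0 : v != 0 by apply: contraNneq p0 => v0; rewrite ev v0 mul0r.
have sze : size p = (size v + size u).-1 by rewrite ev size_mul.
have szu0 : (0 < size u)%N by rewrite size_poly_gt0.
have szv0 : (0 < size v)%N by rewrite size_poly_gt0.
have szup : (size u < size p)%N.
  rewrite ltn_neqAle dvdp_leq // andbT; apply/negP => szup; apply: nup.
  by rewrite -dvdp_size_eqp.
have szv : (size v < size p)%N by move: szu => /eqP szu; lia.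
have [uab|uab] := ltP (u.[a] * u.[b]) 0.
  have [g [girr gu gab]] := IHn _ (leq_trans szup szp) uab.
  by exists g; split=> //; apply: dvdp_trans up.
have vab : v.[a] * v.[b] < 0.
  rewrite ltNge; apply/negP => vab; move: pab; rewrite ltNge => /negP; apply.
  by rewrite ev !hornerM mulrACA mulr_ge0.
have [g [girr gv gab]] := IHn _ (leq_trans szv szp) vab.
by exists g; split=> //; apply: dvdp_trans gv _; rewrite ev dvdp_mulr.
Qed.

End SignChange.

(** * Maximal ordered subfields of a field *)

Lemma maximal_field_cone (C : fieldType) (P0 : field_cone C) :
  exists P : field_cone C, (forall x, P0 x -> P x) /\
    forall P' : field_cone C, (forall x, P x -> P' x) -> forall x, P' x -> P x.
Proof.
pose isC (S : set C) := exists P : field_cone C, forall x, S x <-> P x.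
have [||A [P0A [P AP] maxA]] := @zorn_above C isC P0; first by exists P0.
  move=> F [X0 FX0] FC Ftot.
  (* Each cone axiom involves at most two elements, and a chain places these in a single cone. *)
  have pair S x S' y : F S -> S x -> F S' -> S' y -> exists2 X, F X & X x /\ X y.
    move=> FS Sx FS' Sy; have [SS|SS] := Ftot _ _ FS FS'.
      by exists S' => //; split=> //; exact: SS.
    by exists S => //; split=> //; exact: SS.
  pose U := \bigcup_(X in F) X.
  have U1 : U 1 by exists X0 => //; have [P e] := FC _ FX0; apply/e/cone1.
  have UD x y : U x -> U y -> U (x + y).
    move=> [S FS Sx] [S' FS' Sy]; have [X FX [Xx Xy]] := pair _ _ _ _ FS Sx FS' Sy.
    by exists X => //; have [P e] := FC _ FX; apply/e/coneD; apply/e.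
  have UM x y : U x -> U y -> U (x * y).
    move=> [S FS Sx] [S' FS' Sy]; have [X FX [Xx Xy]] := pair _ _ _ _ FS Sx FS' Sy.
    by exists X => //; have [P e] := FC _ FX; apply/e/coneM; apply/e.
  have UV x : U x -> U x^-1.
    move=> [X FX Xx]; exists X => //; have [P e] := FC _ FX.
    by apply/e/coneV/e.
  have Uanti x : U x -> U (- x) -> x = 0.
    move=> [S FS Sx] [S' FS' Sy]; have [X FX [Xx Xy]] := pair _ _ _ _ FS Sx FS' Sy.
    by have [P e] := FC _ FX; apply: (cone_anti (f := P)); apply/e.
  have Utot x y : U x -> U y -> U (x - y) \/ U (y - x).
    move=> [S FS Sx] [S' FS' Sy]; have [X FX [Xx Xy]] := pair _ _ _ _ FS Sx FS' Sy.
    have [P e] := FC _ FX; have [||?|?] := @cone_total _ P x y; try exact/e.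
      by left; exists X => //; exact/e.
    by right; exists X => //; exact/e.
  by exists (FieldCone U1 UD UM UV Uanti Utot).
exists P; split=> [x /P0A /AP //|P' PP' x P'x].
apply/AP; rewrite -(maxA P') //; first by move=> y /AP /PP'.
by exists P'.
Qed.

Section ExtendCone.
Variables (C : fieldType) (P : field_cone C).
Let F := cone_field P.
Let ev (z : C) (f : {poly F}) : C := (map_poly val f).[z].

(* The new cone is the image in [C], under evaluation at [z], of an ordering of
   [F[X]] whose support is the ideal generated by [g]. *)
Lemma cone_adjoin_root (g : {poly F}) (a b : F) (z : C) :
    irreducible_poly g -> g.[a] * g.[b] < 0 -> ev z g = 0 ->
  exists P' : field_cone C, (forall x, P x -> P' x) /\ (P' z \/ P' (- z)).
Proof.
move=> girr gab gz.
(* With [q] equal to 1, the condition to check is only that -1 is not a weighted sum of squares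
   modulo [g], which the sign change guarantees. *)
have [//||T [subT cT _]] := @prime_cone_above {poly F}
    [set x | exists s h, wsos (@nneg_const F) s /\ x = s + h * g] 1.
- by apply: precone_wsos; [exact: nneg_const1|exact: nneg_constM].
- move=> m [s [h [ss]]]; rewrite !expr1n.
  exact: (sign_change_not_wsos gab).
have [[TD TM TX] TN1 Ttot Tprime] := cT.
have evD f h : ev z (f + h) = ev z f + ev z h by rewrite /ev rmorphD hornerD.
have evN f : ev z (- f) = - ev z f by rewrite /ev rmorphN hornerN.
have evM f h : ev z (f * h) = ev z f * ev z h by rewrite /ev rmorphM hornerM.
have ev1 : ev z 1 = 1 by rewrite /ev rmorph1 hornerC.
have gT : support T g.
  split; apply: subT.
    by exists 0, 1; split; [exact: Wsos0|rewrite add0r mul1r].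
  by exists 0, (- 1); split; [exact: Wsos0|rewrite add0r mulN1r].
have bezout f : ~~ (g %| f) -> exists u v, u * g + v * f = 1.
  rewrite -irreducible_poly_coprime // => /Bezout_eq1_coprimepP[[u v] /= e].
  by exists u, v.
(* The support is no larger than the ideal of [g]: an element not divisible by [g] is coprime to it,
   and a Bezout relation would put 1 in the support. *)
have suppE f : support T f <-> ev z f = 0.
  have [/dvdpP[h ->]|/bezout[u [v e]]] := boolP (g %| f).
    rewrite evM gz mulr0; split=> // _; rewrite mulrC; exact: prime_cone_suppM.
  split=> [sf|fz].
    case: (prime_cone_supp1 cT); rewrite -e; apply: (prime_cone_suppD cT).
      by rewrite mulrC; exact: prime_cone_suppM.
    by rewrite mulrC; exact: prime_cone_suppM.
  have := congr1 (ev z) e; rewrite evD !evM gz fz !mulr0 addr0 ev1.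
  by move=> /eqP; rewrite eq_sym oner_eq0.
pose P' : set C := [set x | exists2 f, T f & x = ev z f].
have T1 : T 1 by have := TX 1; rewrite mulr1.
have P'1 : P' 1 by exists 1.
have P'D x y : P' x -> P' y -> P' (x + y).
  by move=> [f Tf ->] [h Th ->]; exists (f + h) => //; exact: TD.
have P'M x y : P' x -> P' y -> P' (x * y).
  by move=> [f Tf ->] [h Th ->]; exists (f * h) => //; exact: TM.
have P'V x : P' x -> P' x^-1.
  move=> [f Tf ->]; have [f0|f0] := eqVneq (ev z f) 0.
    by rewrite f0 invr0 -f0; exists f.
  have [|u [v e]] := bezout f.
    by apply: contra f0 => /dvdpP[h ->]; rewrite evM gz mulr0.
  have fv : ev z v * ev z f = 1.
    by rewrite -ev1 -e evD !evM gz mulr0 add0r.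
  (* [v] inverts [f] modulo [g], but membership of [v] in [T] is not known; [f * (v * v)] has the
     same value at [z] and is a product of elements of [T]. *)
  exists (f * (v * v)); first exact: TM.
  rewrite !evM -[(_)^-1]mul1r -fv -mulrA divff // mulr1.
  by rewrite mulrA [ev z f * _]mulrC fv mul1r.
have P'anti x : P' x -> P' (- x) -> x = 0.
  move=> [f Tf ->] [h Th e]; apply/suppE; split=> //.
  have /suppE[_ TN] : ev z (f + h) = 0 by rewrite evD -e subrr.
  rewrite (_ : - f = h + - (f + h)); last by ring.
  exact: TD.
have P'tot x y : P' x -> P' y -> P' (x - y) \/ P' (y - x).
  move=> [f Tf ->] [h Th ->]; have [Tfh|Tfh] := Ttot (f - h); [left|right].
    by exists (f - h) => //; rewrite evD evN.
  by exists (h - f); rewrite ?evD ?evN // -opprB.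
exists (FieldCone P'1 P'D P'M P'V P'anti P'tot); split=> [x Px|] /=.
  have Dx : x \in cone_dom P by apply/cone_domP; left.
  exists (ConeField Dx)%:P; last by rewrite /ev map_polyC hornerC.
  apply: subT; exists (ConeField Dx)%:P, 0; split; last by rewrite mul0r addr0.
  rewrite -[_%:P]mulr1 -[X in _ * X](expr1n _ 2); apply: wsos_sqr.
  by exists (ConeField Dx) => //; apply/cone_ge0E.
have evX : ev z 'X = z by rewrite /ev map_polyX hornerX.
by have [TX'|TX'] := Ttot 'X; [left|right]; [exists 'X|exists (- 'X)];
  rewrite ?evN ?evX.
Qed.

End ExtendCone.

(** An irreducible factor with a sign change has a root in [C], and the order extends to the
    subfield generated by that root. By maximality the root already lies in the subfield, so the
    factor is linear. *)
Lemma maximal_cone_ivt (C : closedFieldType) (P : field_cone C) :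
    (forall P' : field_cone C, (forall x, P x -> P' x) -> forall x, P' x -> P x) ->
  Num.real_closed_axiom (cone_field P).
Proof.
move=> maxP p a b ab /andP[pa pb].
have [pa0|pa0] := eqVneq p.[a] 0.
  by exists a; rewrite ?lexx //; apply/rootP.
have [pb0|pb0] := eqVneq p.[b] 0.
  by exists b; rewrite ?ab ?lexx //; apply/rootP.
have pab : p.[a] * p.[b] < 0 by rewrite nmulr_rlt0 lt_neqAle ?pa0 ?pa // eq_sym pb0.
have [g [girr gp gab]] := sign_change_irreducible pab.
have sz : size (map_poly (val : cone_field P -> C) g) != 1%N.
  by rewrite size_map_poly; case: girr => + _; case: size => [|[]].
have /closed_rootP[z /rootP gz] := sz.
have [P' [PP' P'z]] := cone_adjoin_root girr gab gz.
have Dz : z \in cone_dom P.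
  by apply/cone_domP; case: P'z => /(maxP P' PP') ?; [left|right].
pose c : cone_field P := ConeField Dz.
have gc : root g c.
  by rewrite -(fmorph_root (val : {rmorphism cone_field P -> C})); apply/rootP.
have /eqpf_eq[k k0 eg] : g %= 'X - c%:P.
  by rewrite eqp_sym; apply: girr; rewrite ?size_XsubC // dvdp_XsubCl.
exists c; last by rewrite -!dvdp_XsubCl in gc *; exact: dvdp_trans gp.
(* [g] is [k] times ['X - c%:P], so its sign change puts [c] strictly between [a] and [b]. *)
have : (a - c) * (b - c) < 0.
  have k2 : 0 < k ^+ 2 by rewrite exprn_even_gt0.
  rewrite -(pmulr_rlt0 _ k2).
  move: gab; rewrite eg !(hornerZ, hornerXsubC) => gab.
  by rewrite (_ : k ^+ 2 * _ = k * (a - c) * (k * (b - c))) //; ring.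
by move=> acb; apply/andP; split; nra.
Qed.

(** * From countable ordered rings to real closed fields *)

Lemma countable_idomain_closed_field (D : idomainType) (f : D -> nat)
    (g : nat -> option D) :
  pcancel f g -> exists (C : closedFieldType) (j : {rmorphism D -> C}), injective j.
Proof.
move=> fK.
pose frat (c : nat * nat) : option {ratio D} :=
  if g c.1 is Some x then omap (Ratio x) (g c.2) else None.
pose code (x : {fraction D}) := pickle (f (val (repr x)).1, f (val (repr x)).2).
pose decode n := omap \pi_{fraction D}%qT (obind frat (unpickle n)).
have codeK : pcancel code decode.
  move=> x; rewrite /decode /code pickleK /= /frat /= !fK /= -[in RHS](reprK x).
  (* A representative has nonzero denominator, so [Ratio] does not return its default value. *)
  case: (repr x) => -[a b] /= b0; congr (Some (\pi_{fraction D}%qT _)).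
  by apply: val_inj; rewrite val_insubd /= b0.
pose cF := isCountable.Build {fraction D} codeK.
pose Fc : countFieldType := HB.pack {fraction D} cF.
have [C [j _]] := countable_algebraic_closure Fc.
pose j' : {rmorphism {fraction D} -> C} := j.
exists C, (j' \o @tofrac D : {rmorphism D -> C}) => x y /fmorph_inj xy.
by apply/eqP; rewrite -subr_eq0 -tofrac_eq0 tofracB xy subrr.
Qed.

(** Units and inverses are chosen classically, which gives the ring the structure of an integral
    domain with a fraction field. *)
Lemma countable_domain_closed_field (Q : comNzRingType) (f : Q -> nat)
    (g : nat -> option Q) :
    pcancel f g -> (forall x y : Q, x * y = 0 -> (x == 0) || (y == 0)) ->
  exists (C : closedFieldType) (j : {rmorphism Q -> C}), injective j.
Proof.
move=> fK domQ.
pose unitQ : pred Q := fun x => `[< exists y, y * x = 1 >].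
pose invQ (x : Q) : Q :=
  if pselect (exists y, y * x = 1) is left ex then projT1 (cid ex) else x.
have mulVQ : {in unitQ, left_inverse 1 invQ *%R}.
  by move=> x /asboolP ux; rewrite /invQ; case: pselect => // ex; case: cid.
have unitQP (x y : Q) : y * x = 1 -> unitQ x.
  by move=> yx; apply/asboolP; exists y.
have invQ_out : {in [predC unitQ], invQ =1 id}.
  by move=> x /asboolP nux; rewrite /invQ; case: pselect.
pose U := GRing.ComNzRing_hasMulInverse.Build Q mulVQ unitQP invQ_out.
pose I := GRing.ComUnitRing_isIntegral.Build (HB.pack_for comUnitRingType Q U) domQ.
pose D : idomainType := HB.pack Q U I.
have [C [j jinj]] := @countable_idomain_closed_field D f g fK.
by exists C, j.
Qed.

(** The quotient by the support is a domain, and coding each class by a representative keeps it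
    countable. *)
Lemma prime_cone_closed_field (B : comNzRingType) (f : B -> nat)
    (g : nat -> option B) (T : set B) : pcancel f g -> prime_cone T ->
  exists (C : closedFieldType) (j : {rmorphism B -> C}),
    forall b, j b = 0 <-> support T b.
Proof.
move=> fK cT.
pose I : {pred B} := fun b => `[< support T b >].
have IP b : reflect (support T b) (b \in I) by exact: asboolP.
have idI : idealr_closed I.
  split; first by apply/IP; exact: prime_cone_supp0.
    by apply/IP; exact: prime_cone_supp1.
  move=> a u v /IP su /IP sv; apply/IP; apply: prime_cone_suppD => //.
  by rewrite mulrC; exact: prime_cone_suppM.
have prI : prime_idealr_closed I.
  have [_ _ _ prT] := cT => u v /IP /prT[?|?]; apply/orP; [left|right]; exact/IP.
pose I1 := isIdealr.Build B I idI.
pose I2 : idealr B := HB.pack I I1.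
pose Q : comNzRingType := {ideal_quot I2}.
have Q0 b : (\pi_{ideal_quot I2}%qT b == 0 :> Q) = (b \in I).
  by rewrite -(rmorph0 \pi_{ideal_quot I2}%qT) -Quotient.idealrBE subr0.
have domQ (x y : Q) : x * y = 0 -> (x == 0) || (y == 0).
  rewrite -[x]reprK -[y]reprK -rmorphM => /eqP; rewrite !Q0; exact: prI.
have codeK : pcancel (fun x : Q => f (repr x))
    (fun n => omap \pi_{ideal_quot I2}%qT (g n)).
  by move=> x; rewrite fK /= reprK.
have [C [j jinj]] := countable_domain_closed_field codeK domQ.
pose p : {rmorphism B -> Q} := \pi_{ideal_quot I2}%qT.
exists C, (j \o p : {rmorphism B -> C}) => b; rewrite /= -(rmorph0 j).
by split=> [/jinj/eqP|/IP]; [rewrite Q0 => /IP|rewrite -Q0 => /eqP ->].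
Qed.

(** Quotients of images of elements of [T] form a field cone in the closed field. A maximal cone
    above it defines a real closed field, and the order there restricts to [T] because [T] is
    total. *)
Theorem prime_cone_rcf (B : comNzRingType) (f : B -> nat)
    (g : nat -> option B) (T : set B) : pcancel f g -> prime_cone T ->
  exists (K : rcfType) (j : {rmorphism B -> K}), forall b, T b <-> 0 <= j b.
Proof.
move=> fK cT; have [C [j jT]] := prime_cone_closed_field fK cT.
have [[TD TM TX] TN1 Ttot Tprime] := cT.
have T1 : T 1 by have := TX 1; rewrite mulr1.
have T0 : T 0 by have := TX 0; rewrite mulr0.
pose P0 : set C := [set x | exists a b, [/\ T a, T b, j b != 0 & x = j a / j b]].
have P1 : P0 1 by exists 1, 1; rewrite rmorph1 divr1 oner_eq0.
have PD x y : P0 x -> P0 y -> P0 (x + y).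
  move=> [a [b [Ta Tb b0 ->]]] [c [d [Tc Td d0 ->]]].
  exists (a * d + c * b), (b * d); split; [by apply: TD; apply: TM|exact: TM| |].
    by rewrite rmorphM mulf_neq0.
  by rewrite addf_div // rmorphD !rmorphM.
have PM x y : P0 x -> P0 y -> P0 (x * y).
  move=> [a [b [Ta Tb b0 ->]]] [c [d [Tc Td d0 ->]]].
  exists (a * c), (b * d); split; [exact: TM|exact: TM| |].
    by rewrite rmorphM mulf_neq0.
  by rewrite mulf_div !rmorphM.
have PV x : P0 x -> P0 x^-1.
  move=> [a [b [Ta Tb b0 ->]]]; have [a0|a0] := eqVneq (j a) 0.
    by exists a, b; rewrite a0 mul0r invr0.
  by exists b, a; rewrite invf_div.
have Panti x : P0 x -> P0 (- x) -> x = 0.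
  move=> [a [b [Ta Tb b0 ->]]] [c [d [Tc Td d0 e]]].
  have /jT[_ sN] : j (a * d + c * b) = 0.
    rewrite rmorphD !rmorphM.
    have /eqP : j a / j b + j c / j d = 0 by rewrite -e subrr.
    rewrite addf_div // mulf_eq0 invr_eq0 (negPf (mulf_neq0 b0 d0)) orbF.
    by move=> /eqP.
  (* Clearing denominators puts [a * d + c * b] in the support. Both summands lie in [T], so [a * d]
     is in the support, and primality applies. *)
  have /Tprime[/jT ->|/jT d0'] : support T (a * d).
    split; first exact: TM.
    rewrite (_ : - _ = - (a * d + c * b) + c * b); last by ring.
    by apply: TD => //; exact: TM.
  - by rewrite mul0r.
  - by rewrite d0' eqxx in d0.
have Ptot x y : P0 x -> P0 y -> P0 (x - y) \/ P0 (y - x).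
  move=> [a [b [Ta Tb b0 ->]]] [c [d [Tc Td d0 ->]]].
  have [Tn|Tn] := Ttot (a * d - c * b); [left|right].
    exists (a * d - c * b), (b * d); split=> //; first exact: TM.
      by rewrite rmorphM mulf_neq0.
    by rewrite -mulNr addf_div // rmorphB !rmorphM mulNr.
  exists (c * b - a * d), (d * b); split; [by rewrite -opprB|exact: TM| |].
    by rewrite rmorphM mulf_neq0.
  by rewrite -mulNr addf_div // rmorphB !rmorphM mulNr.
have [P [P0P maxP]] := maximal_field_cone (FieldCone P1 PD PM PV Panti Ptot).
pose R := Num.RealField_isClosed.Build (cone_field P) (maximal_cone_ivt maxP).
pose K : rcfType := HB.pack (cone_field P) R.
have P0j b : T b -> P (j b).
  by move=> Tb; apply: P0P; exists b, 1; rewrite rmorph1 divr1 oner_eq0.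
have Dj b : j b \in cone_dom P.
  by apply/cone_domP; have [/P0j|/P0j] := Ttot b; [left|right; rewrite -rmorphN].
pose k (b : B) : cone_field P := ConeField (Dj b).
have kB : zmod_morphism k by move=> x y; apply: val_inj; rewrite /= !rmorphB.
have kM : monoid_morphism k.
  by split=> [|x y]; apply: val_inj; rewrite /= ?rmorph1 ?rmorphM.
pose k1 := GRing.isZmodMorphism.Build _ _ k kB.
pose k2 := GRing.isMonoidMorphism.Build _ _ k kM.
pose k' : {rmorphism B -> cone_field P} := HB.pack k k1 k2.
exists K, k' => b; split=> [Tb|/cone_ge0E /= Pb]; first by apply/cone_ge0E/P0j.
(* If instead [- b] lies in [T], then [j b] and its opposite are both in [P]. Hence [j b] is zero
   and [b] lies in the support, so in [T]. *)
have [//|/[dup] Tn /P0j] := Ttot b; rewrite rmorphN => /(cone_anti Pb).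
by move=> /jT[].
Qed.

(** * Transfer between real closed fields *)

(* The elimination procedure of [qe_rcf] is run over the rationals; since it
   commutes with field extension, one rational formula then decides the same
   existential statement in any two real closed fields. *)
Section MapFormula.
Import qe_rcf_th qe_rcf.
Variables (F0 F1 : realFieldType) (phi : {rmorphism F0 -> F1}).

Fixpoint map_term (t : qe_rcf.term F0) : qe_rcf.term F1 :=
  match t with
  | Var n => Var F1 n
  | Const x => Const (phi x)
  | NatConst n => NatConst F1 n
  | Add u v => Add (map_term u) (map_term v)
  | Opp u => Opp (map_term u)
  | NatMul u n => NatMul (map_term u) n
  | Mul u v => Mul (map_term u) (map_term v)
  | Exp u n => Exp (map_term u) n
  end.

Fixpoint map_formula (f : qe_rcf.formula F0) : qe_rcf.formula F1 :=
  match f with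
  | Bool b => Bool b
  | Equal t u => Equal (map_term t) (map_term u)
  | Lt t u => Lt (map_term t) (map_term u)
  | Le t u => Le (map_term t) (map_term u)
  | And f g => And (map_formula f) (map_formula g)
  | Or f g => Or (map_formula f) (map_formula g)
  | Implies f g => Implies (map_formula f) (map_formula g)
  | Not f => Not (map_formula f)
  end.

Local Notation mt := map_term.
Local Notation mf := map_formula.
Local Notation mp := (map map_term).
Local Notation mps := (map (map map_term)).
Local Notation fF0 := (qe_rcf.formula F0).
Local Notation fF1 := (qe_rcf.formula F1).
Implicit Types (p q r : polyF F0) (t : qe_rcf.term F0).

(** The elimination procedures are written in continuation-passing style; commutation is therefore
    stated for any two continuations that correspond under the translation, here and below. *)
Lemma map_Size p (k : nat -> fF0) k' :
  (forall n, mf (k n) = k' n) -> mf (Size p k) = Size (mp p) k'.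
Proof.
elim: p k k' => [|c p IH] k k' kk' /=; first exact: kk'.
by apply: IH => -[|n]; rewrite /= ?kk'.
Qed.

Lemma map_Isnull p (k : bool -> fF0) k' :
  (forall n, mf (k n) = k' n) -> mf (Isnull p k) = Isnull (mp p) k'.
Proof. by move=> kk'; apply: map_Size => n; exact: kk'. Qed.

Lemma map_LtSize p q (k : bool -> fF0) k' :
  (forall n, mf (k n) = k' n) -> mf (LtSize p q k) = LtSize (mp p) (mp q) k'.
Proof. by move=> kk'; apply: map_Size => n; apply: map_Size => m; exact: kk'. Qed.

Lemma map_LeadCoef p k k' : (forall t, mf (k t) = k' (mt t)) ->
  mf (LeadCoef p k) = LeadCoef (mp p) k'.
Proof.
elim: p k k' => [|c p IH] k k' kk' /=; first by rewrite kk' /= rmorph0.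
by apply: IH => l; rewrite /= !kk'.
Qed.

Lemma map_AmulXn t n : mp (AmulXn t n) = AmulXn (mt t) n.
Proof. by elim: n => //= n ->; rewrite rmorph0. Qed.

Lemma map_AddPoly p q : mp (AddPoly p q) = AddPoly (mp p) (mp q).
Proof. by elim: p q => [|a p IH] [|b q] //=; rewrite IH. Qed.

Lemma map_ScalPoly t p : mp (ScalPoly t p) = ScalPoly (mt t) (mp p).
Proof. by rewrite /ScalPoly -!map_comp; apply: eq_map. Qed.

Lemma map_MulPoly p q : mp (MulPoly p q) = MulPoly (mp p) (mp q).
Proof. by elim: p => //= a p IH; rewrite map_AddPoly map_ScalPoly /= IH. Qed.

Lemma map_ExpPoly p n : mp (ExpPoly p n) = ExpPoly (mp p) n.
Proof.
case: n => // n; rewrite /ExpPoly !iteropS.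
by elim: n => //= n IH; rewrite map_MulPoly IH.
Qed.

Lemma map_OppPoly p : mp (OppPoly p) = OppPoly (mp p).
Proof. by rewrite /OppPoly map_ScalPoly /= rmorphN1. Qed.

Lemma map_NatMulPoly n p : mp (NatMulPoly n p) = NatMulPoly n (mp p).
Proof. exact: map_ScalPoly. Qed.

Lemma map_Deriv p : mp (Deriv p) = Deriv (mp p).
Proof. by elim: p => //= a p IH; rewrite map_AddPoly /= IH. Qed.

Lemma map_Rediv_rec_loop q sq cq c qq r n k k' :
    (forall c qq r, mf (k (c, qq, r)) = k' (c, mp qq, mp r)) ->
  mf (Rediv_rec_loop q sq cq c qq r n k) =
  Rediv_rec_loop (mp q) sq (mt cq) c (mp qq) (mp r) n k'.
Proof.
move=> kk'; elim: n c qq r => [|n IH] c qq r /=; apply: map_Size => sr;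
  case: ifP => _ //; apply: map_LeadCoef => l; rewrite ?kk' ?IH;
  by rewrite !map_AddPoly map_OppPoly !map_MulPoly map_AmulXn.
Qed.

Lemma map_Rediv p q k k' :
    (forall c qq r, mf (k (c, qq, r)) = k' (c, mp qq, mp r)) ->
  mf (Rediv p q k) = Rediv (mp p) (mp q) k'.
Proof.
move=> kk'; apply: map_Isnull => -[]; first by rewrite kk' /= rmorph0.
apply: map_Size => sq; apply: map_Size => sp; apply: map_LeadCoef => lq.
by rewrite (map_Rediv_rec_loop _ _ _ _ _ _ _ kk') /= rmorph0.
Qed.

Lemma map_Rmod p q k k' : (forall r, mf (k r) = k' (mp r)) ->
  mf (Rmod p q k) = Rmod (mp p) (mp q) k'.
Proof. by move=> kk'; apply: map_Rediv => *; exact: kk'. Qed.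

Lemma map_Rscal p q (k : nat -> fF0) k' : (forall n, mf (k n) = k' n) ->
  mf (Rscal p q k) = Rscal (mp p) (mp q) k'.
Proof. by move=> kk'; apply: map_Rediv => *; exact: kk'. Qed.

Lemma map_Rgcd_loop n p q k k' : (forall r, mf (k r) = k' (mp r)) ->
  mf (Rgcd_loop n p q k) = Rgcd_loop n (mp p) (mp q) k'.
Proof.
move=> kk'; elim: n p q => [|n IH] p q /=; apply: map_Rmod => r;
  by apply: map_Isnull => -[]; rewrite ?kk' ?IH.
Qed.

Lemma map_Rgcd p q k k' : (forall r, mf (k r) = k' (mp r)) ->
  mf (Rgcd p q k) = Rgcd (mp p) (mp q) k'.
Proof.
move=> kk'; apply: map_LtSize => -[]; apply: map_Isnull => -[];
  by rewrite ?kk' //; apply: map_Size => n; exact: map_Rgcd_loop.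
Qed.

Lemma map_BigRgcd (ps : seq (polyF F0)) k k' :
  (forall r, mf (k r) = k' (mp r)) ->
  mf (BigRgcd ps k) = BigRgcd (mps ps) k'.
Proof.
elim: ps k k' => [|p ps IH] k k' kk' /=; first by rewrite kk' /= rmorph0.
by apply: IH => r; exact: map_Rgcd.
Qed.

Lemma map_Changes s (k : nat -> fF0) k' : (forall n, mf (k n) = k' n) ->
  mf (Changes s k) = Changes (mp s) k'.
Proof.
elim: s k k' => [|a s IH] k k' kk' /=; first exact: kk'.
by apply: (IH) => n; rewrite /= !kk'; case: (s).
Qed.

Lemma map_SeqPInfty (ps : seq (polyF F0)) k k' :
  (forall r, mf (k r) = k' (mp r)) ->
  mf (SeqPInfty ps k) = SeqPInfty (mps ps) k'.
Proof.
elim: ps k k' => [|p ps IH] k k' kk' /=; first exact: kk'.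
by apply: map_LeadCoef => l; apply: IH => s; exact: kk'.
Qed.

Lemma map_SeqMInfty (ps : seq (polyF F0)) k k' :
  (forall r, mf (k r) = k' (mp r)) ->
  mf (SeqMInfty ps k) = SeqMInfty (mps ps) k'.
Proof.
elim: ps k k' => [|p ps IH] k k' kk' /=; first exact: kk'.
apply: map_LeadCoef => l; apply: map_Size => n; apply: IH => s.
by rewrite kk' /= rmorphN1.
Qed.

Lemma map_ChangesPoly (ps : seq (polyF F0)) (k : int -> fF0) k' :
  (forall n, mf (k n) = k' n) ->
  mf (ChangesPoly ps k) = ChangesPoly (mps ps) k'.
Proof.
move=> kk'; apply: map_SeqMInfty => s; apply: map_SeqPInfty => s'.
by apply: map_Changes => n; apply: map_Changes => m; exact: kk'.
Qed.

Lemma map_NextMod p q k k' : (forall r, mf (k r) = k' (mp r)) ->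
  mf (NextMod p q k) = NextMod (mp p) (mp q) k'.
Proof.
move=> kk'; apply: map_LeadCoef => l; apply: map_Rscal => n.
by apply: map_Rmod => r; rewrite kk' map_ScalPoly.
Qed.

Lemma map_ModsAux p q n k k' : (forall s : seq (polyF F0), mf (k s) = k' (mps s)) ->
  mf (ModsAux p q n k) = ModsAux (mp p) (mp q) n k'.
Proof.
elim: n p q k k' => [|n IH] p q k k' kk' /=; first exact: kk'.
apply: map_Isnull => -[]; first exact: kk'.
by apply: map_NextMod => r; apply: IH => s; exact: kk'.
Qed.

Lemma map_Mods p q k k' : (forall s : seq (polyF F0), mf (k s) = k' (mps s)) ->
  mf (Mods p q k) = Mods (mp p) (mp q) k'.
Proof.
by move=> kk'; apply: map_Size => n; apply: map_Size => m; exact: map_ModsAux.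
Qed.

Lemma map_PolyComb (sq : seq (polyF F0)) sc :
  mp (PolyComb sq sc) = PolyComb (mps sq) sc.
Proof.
rewrite /PolyComb size_map; move: (iota _ _) => s.
elim: s => //= i s IH; rewrite map_MulPoly map_ExpPoly; congr MulPoly => //.
congr ExpPoly; have [lti|lei] := ltnP i (size sq); first by rewrite (nth_map [::]).
by rewrite !nth_default ?size_map.
Qed.

Lemma map_Pcq (sq : seq (polyF F0)) i : mp (Pcq sq i) = Pcq (mps sq) i.
Proof.
rewrite /Pcq size_map; have [lti|lei] := ltnP i (size (sg_tab (size sq))).
  by rewrite !(nth_map [::]) // map_PolyComb.
by rewrite !nth_default ?size_map.
Qed.

Lemma map_TaqR p q (k : int -> fF0) k' : (forall n, mf (k n) = k' n) ->
  mf (TaqR p q k) = TaqR (mp p) (mp q) k'.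
Proof.
move=> kk'; rewrite /TaqR -map_Deriv -map_MulPoly.
by apply: map_Mods => s; exact: map_ChangesPoly.
Qed.

Lemma map_TaqsR p (sq : seq (polyF F0)) i k k' :
  (forall t, mf (k t) = k' (mt t)) ->
  mf (TaqsR p sq i k) = TaqsR (mp p) (mps sq) i k'.
Proof.
move=> kk'; rewrite /TaqsR -map_Pcq.
by apply: map_TaqR => n; rewrite kk' /= rmorph_int.
Qed.

Lemma map_BoundingPoly (sq : seq (polyF F0)) :
  mp (BoundingPoly sq) = BoundingPoly (mps sq).
Proof.
rewrite /BoundingPoly map_Deriv; congr Deriv.
by elim: sq => //= q sq IH; rewrite map_MulPoly IH.
Qed.

(** The coefficients come from the inverse of an integer matrix, and field morphisms preserve
    integers and matrix inversion. Outside the index range both sides are the default 0. *)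
Lemma map_coefs n i : phi (coefs F0 n i) = coefs F1 n i.
Proof.
have size_s (S : Type) (f : 'I_(3 ^ n) -> S) :
    size [seq f k | k <- enum 'I_(3 ^ n)] = (3 ^ n)%N.
  by rewrite size_map size_enum_ord.
rewrite /coefs; have [lti|lei] := ltnP i (3 ^ n)%N; last first.
  by rewrite ![nth _ _ i]nth_default ?size_s // rmorph0.
have mapV : map_mx phi (invmx (map_mx intr (ctmat n))) =
    invmx (map_mx intr (ctmat n)).
  rewrite map_invmx -map_mx_comp; congr invmx.
  by apply: eq_map_mx => x; exact: rmorph_int.
by rewrite !(nth_map (Ordinal lti)) -?enumT ?size_enum_ord // !castmxE -mapV mxE.
Qed.

Lemma map_Coefs n i : mt (Coefs F0 n i) = Coefs F1 n i.
Proof.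
case: n => [|[|n]] /=; last by rewrite map_coefs.
  by rewrite rmorph_nat.
by case: i => [|[|[|[|i]]]] /=; rewrite ?fmorphV ?rmorph_nat ?rmorph0.
Qed.

Lemma map_CcountWeak p (sq : seq (polyF F0)) k k' :
  (forall t, mf (k t) = k' (mt t)) ->
  mf (CcountWeak p sq k) = CcountWeak (mp p) (mps sq) k'.
Proof.
rewrite /CcountWeak size_map => kk'; move: (3 ^ _)%N => n.
rewrite -[NatConst F1 0]/(mt (NatConst F0 0)); move: (NatConst F0 0) => s.
elim: n s k k' kk' => [|n IH] s k k' kk' /=; first exact: kk'.
apply: map_TaqsR => t; rewrite (IH _ _ _ kk') -map_Coefs.
by [].
Qed.

Lemma map_CcountGt0 (sp sq : seq (polyF F0)) :
  mf (CcountGt0 sp sq) = CcountGt0 (mps sp) (mps sq).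
Proof.
rewrite /CcountGt0; apply: map_BigRgcd => p; apply: map_Isnull => -[] /=.
  2: by apply: map_CcountWeak => t.
rewrite -map_BoundingPoly; apply: map_CcountWeak => t /=.
congr Or; last congr Or.
  by elim: sq => //= q sq IH; congr And => //; exact: map_LeadCoef.
elim: sq => //= q sq IH; congr And => //.
by apply: map_Size => n; exact: map_LeadCoef.
Qed.

Lemma map_abstrX n t : mp (abstrX n t) = abstrX n (mt t).
Proof.
elim: t => //=.
- by move=> m; case: ifP.
- by move=> t IHt u IHu; rewrite map_AddPoly IHt IHu.
- by move=> t IHt; rewrite map_OppPoly IHt.
- by move=> t IHt m; rewrite map_NatMulPoly IHt.
- by move=> t IHt u IHu; rewrite map_MulPoly IHt IHu.
- by move=> t IHt m; rewrite map_ExpPoly IHt.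
Qed.

End MapFormula.

(** * Rational terms evaluated in commutative rings *)

Section TermEval.
Import qe_rcf_th qe_rcf.

(** The values lie in an arbitrary commutative ring because the same terms are evaluated in
    polynomial rings and in real closed fields. *)
Fixpoint term_eval (A : comNzRingType) (h : rat -> A) (e : seq A)
    (t : qe_rcf.term rat) : A :=
  match t with
  | Var n => e`_n
  | Const x => h x
  | NatConst n => n%:R
  | Add u v => term_eval h e u + term_eval h e v
  | Opp u => - term_eval h e u
  | NatMul u n => term_eval h e u *+ n
  | Mul u v => term_eval h e u * term_eval h e v
  | Exp u n => term_eval h e u ^+ n
  end.

Lemma eq_term_eval (A : comNzRingType) (h h' : rat -> A) (e e' : seq A) t :
  h =1 h' -> (forall i, e`_i = e'`_i) -> term_eval h e t = term_eval h' e' t.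
Proof. by move=> hh ee; elim: t => //=; do ?[move=> ? ->|move=> ?]. Qed.

Lemma nth_map_additive (A A' : nmodType) (g : {additive A -> A'}) (e : seq A) i :
  (map g e)`_i = g e`_i.
Proof.
have [ltn|len] := ltnP i (size e); first by rewrite (nth_map 0).
by rewrite !nth_default ?size_map ?raddf0.
Qed.

Lemma rmorph_term_eval (A A' : comNzRingType) (g : {rmorphism A -> A'})
    (h : rat -> A) (e : seq A) t :
  g (term_eval h e t) = term_eval (g \o h) (map g e) t.
Proof.
elim: t => //=.
- by move=> n; rewrite nth_map_additive.
- by move=> n; rewrite rmorph_nat.
- by move=> t IHt u IHu; rewrite rmorphD IHt IHu.
- by move=> t IHt; rewrite rmorphN IHt.
- by move=> t IHt n; rewrite rmorphMn IHt.
- by move=> t IHt u IHu; rewrite rmorphM IHt IHu.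
- by move=> t IHt n; rewrite rmorphXn IHt.
Qed.

End TermEval.

Section Transfer.
Import qe_rcf_th qe_rcf.

Local Notation reval := (term_eval ratr).

Lemma eval_map_term (F : realFieldType) (e : seq F) t :
  eval e (map_term ratr t) = reval e t.
Proof. by elim: t => //=; do ?[move=> ? ->|move=> ?]. Qed.

(** A comparison is recorded as the difference of its two sides, since the sign of that difference
    decides it. *)
Fixpoint atoms (f : qe_rcf.formula rat) : seq (qe_rcf.term rat) :=
  match f with
  | Bool b => [::]
  | Equal t u => [:: Add t (Opp u)]
  | Lt t u => [:: Add t (Opp u)]
  | Le t u => [:: Add t (Opp u)]
  | And f g => atoms f ++ atoms g
  | Or f g => atoms f ++ atoms g
  | Implies f g => atoms f ++ atoms g
  | Not f => atoms f
  end.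

Definition signs (F : realFieldType) (e : seq F) (ts : seq (qe_rcf.term rat)) :=
  [seq sgz (reval e t) | t <- ts].

Lemma signs_cat (K L : realFieldType) (e1 : seq K) (e2 : seq L) ts us :
  signs e1 (ts ++ us) = signs e2 (ts ++ us) ->
  signs e1 ts = signs e2 ts /\ signs e1 us = signs e2 us.
Proof.
rewrite /signs !map_cat => /eqP; rewrite eqseq_cat ?size_map //.
by move=> /andP[/eqP ? /eqP ?].
Qed.

Lemma qf_eval_signs (K L : realFieldType) (e1 : seq K) (e2 : seq L) f :
    signs e1 (atoms f) = signs e2 (atoms f) ->
  qf_eval e1 (map_formula ratr f) = qf_eval e2 (map_formula ratr f).
Proof.
elim: f => //=.
- move=> t u [e]; rewrite !eval_map_term -[LHS]subr_eq0 -[RHS]subr_eq0.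
  by rewrite -sgz_eq0 e sgz_eq0.
- move=> t u [e]; rewrite !eval_map_term -[LHS]subr_lt0 -[RHS]subr_lt0.
  by rewrite -sgz_lt0 e sgz_lt0.
- move=> t u [e]; rewrite !eval_map_term -[LHS]subr_le0 -[RHS]subr_le0.
  by rewrite -sgz_le0 e sgz_le0.
- by move=> f IHf g IHg /signs_cat[/IHf -> /IHg ->].
- by move=> f IHf g IHg /signs_cat[/IHf -> /IHg ->].
- by move=> f IHf g IHg /signs_cat[/IHf -> /IHg ->].
- by move=> f IHf /IHf ->.
Qed.

(** Elimination commutes with [ratr], so correctness of the procedure over [F] applies to the
    formula computed over the rationals. *)
Lemma eval_CcountGt0_abstrX (F : rcfType) n (sp sq : seq (qe_rcf.term rat)) e :
  qf_eval e (map_formula (ratr : {rmorphism rat -> F})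
    (CcountGt0 (map (abstrX n) sp) (map (abstrX n) sq))) <->
  exists x, all (fun t => reval (set_nth 0 e n x) t == 0) sp &&
            all (fun t => 0 < reval (set_nth 0 e n x) t) sq.
Proof.
rewrite map_CcountGt0 eval_CcountGt0 -!map_comp.
have E x t :
    (eval_poly e (map (map_term (ratr : {rmorphism rat -> F})) (abstrX n t))).[x] =
    reval (set_nth 0 e n x) t.
  by rewrite map_abstrX abstrXP eval_map_term.
have E2 x : \big[andb/true]_(p <- [seq ([eta eval_poly e] \o map (map_term ratr)
       \o abstrX n) t | t <- sp]) (p.[x] == 0)
  = all (fun t => reval (set_nth 0 e n x) t == 0) sp.
  by rewrite big_map big_all; apply: eq_all => t /=; rewrite E.
have E3 x : \big[andb/true]_(p <- [seq ([eta eval_poly e] \o map (map_term ratr)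
       \o abstrX n) t | t <- sq]) (0 < p.[x])
  = all (fun t => 0 < reval (set_nth 0 e n x) t) sq.
  by rewrite big_map big_all; apply: eq_all => t /=; rewrite E.
split=> [/ccount_gt0P[x]|[x H]]; last apply/ccount_gt0P; exists x.
  by rewrite -E2 -E3.
by rewrite -E2 -E3 in H.
Qed.

(** One-way implications suffice because exactly one of the three sign conditions holds at [e1]. *)
Lemma signs_eq (K L : realFieldType) (e1 : seq K) (e2 : seq L) ts :
    all (fun t => (reval e1 t == 0) ==> (reval e2 t == 0)) ts ->
    all (fun t => (0 < reval e1 t) ==> (0 < reval e2 t)) ts ->
    all (fun t => (reval e1 t < 0) ==> (reval e2 t < 0)) ts ->
  signs e1 ts = signs e2 ts.
Proof.
elim: ts => //= t ts IH /andP[z0 zs] /andP[p0 ps] /andP[n0 ns].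
congr (_ :: _); last exact: IH.
case: (sgzP (reval e1 t)) z0 p0 n0 => _ /=.
- by move=> /eqP -> _ _; rewrite sgz0.
- by move=> _ + _ => /gtr0_sgz.
- by move=> _ _ /ltr0_sgz.
Qed.

(* Eliminating the variable [n] from the sign conditions that [e1'] satisfies on
   [ts] leaves a formula in the remaining variables, whose truth depends only
   on the signs of its atoms; these are transferred by induction. *)
Lemma sign_transfer (K L : rcfType) (e1 : seq K) (e2 : seq L) :
    (forall t, sgz (reval e1 t) = sgz (reval e2 t)) ->
  forall n (e1' : seq K) ts, (forall i, (n <= i)%N -> e1'`_i = e1`_i) ->
  exists2 e2' : seq L, forall i, (n <= i)%N -> e2'`_i = e2`_i
    & signs e1' ts = signs e2' ts.
Proof.
move=> e12; elim=> [|n IHn] e1' ts e1'P.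
  exists e2 => //; apply: eq_map => t; rewrite -e12; congr sgz.
  by apply: eq_term_eval => // i; rewrite e1'P.
pose sp := [seq t <- ts | reval e1' t == 0].
(* Negativity is turned into positivity of the opposite term, as elimination handles only equations
   and strict positivity. *)
pose sq := [seq t <- ts | 0 < reval e1' t] ++
           [seq Opp t | t <- ts & reval e1' t < 0].
pose f := CcountGt0 (map (abstrX n) sp) (map (abstrX n) sq).
(* Variable [n] is reset to its value in [e1], so that the induction hypothesis applies; the formula
   [f] quantifies that variable away. *)
pose e1n := set_nth 0 e1' n e1`_n.
have [i nlei|e2n e2nP] := IHn e1n (atoms f).
  rewrite nth_set_nth /=; case: eqP => [->//|/eqP neq].
  by apply: e1'P; rewrite ltn_neqAle eq_sym neq.
have back i : (set_nth 0 e1n n e1'`_n)`_i = e1'`_i.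
  by rewrite !nth_set_nth /= !nth_set_nth /=; case: eqP => [->|].
move=> /qf_eval_signs ef.
have /eval_CcountGt0_abstrX[y] : qf_eval e2n (map_formula ratr f).
  rewrite -ef; apply/eval_CcountGt0_abstrX; exists e1'`_n.
  have E t : reval (set_nth 0 e1n n e1'`_n) t = reval e1' t by exact: eq_term_eval.
  rewrite all_cat all_map !all_filter -!all_predI; apply/allT => t /=.
  by rewrite !E oppr_gt0 !implybb.
rewrite all_cat all_map !all_filter => /andP[p0 /andP[q0 n0]].
exists (set_nth 0 e2n n y) => [i lti|].
  rewrite nth_set_nth /=; case: eqP => [ein|_]; last exact: e2nP (ltnW lti).
  by rewrite ein ltnn in lti.
apply: signs_eq => //.
by apply: sub_all n0 => t /=; rewrite oppr_gt0.
Qed.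

End Transfer.

(** * The real Nullstellensatz *)

Section MpolyTerm.
Import qe_rcf_th qe_rcf.
Variables (n : nat) (R : numFieldType).
Local Notation A := {mpoly R[n]}.

(** The first [n] variables stand for the indeterminates and the later ones for coefficients, so
    that a polynomial over [R] becomes the value of a term with rational constants. *)
Definition mpoly_env (c : seq R) : seq A :=
  [seq 'X_i | i : 'I_n] ++ [seq a%:MP | a <- c].

Definition mpoly_term_eval (c : seq R) : qe_rcf.term rat -> A :=
  term_eval (@mpolyC n R \o ratr) (mpoly_env c).

Lemma mpoly_env_var c (i : 'I_n) : (mpoly_env c)`_i = 'X_i.
Proof.
rewrite nth_cat size_map size_enum_ord ltn_ord (nth_map i) ?size_enum_ord //.
by rewrite nth_ord_enum.
Qed.

Lemma mpoly_env_const c i : (mpoly_env c)`_(n + i) = (c`_i)%:MP.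
Proof.
rewrite nth_cat size_map size_enum_ord ltnNge leq_addr /= addnC addnK.
have [lti|lei] := ltnP i (size c); first by rewrite (nth_map 0).
by rewrite !nth_default ?size_map // mpolyC0.
Qed.

(** Each coefficient receives a new variable. The prefix [c0] and the suffix [c'] allow several
    polynomials to share one list of coefficients. *)
Lemma mpoly_termP (c0 : seq R) (p : A) : exists t c, forall c',
  mpoly_term_eval (c0 ++ c ++ c') t = p.
Proof.
elim/mpolyind: p => [|a m p _ _ [t [c tp]]].
  by exists (NatConst rat 0), [::].
pose mon : qe_rcf.term rat :=
  foldr (fun i : 'I_n => Mul (Exp (Var rat i) (m i))) (NatConst rat 1) (enum 'I_n).
(* The index is the position of the new coefficient [a] after the indeterminates; [t] keeps its
   value because [a] can be counted as part of the suffix. *)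
exists (Add (Mul (Var rat (n + size (c0 ++ c))) mon) t), (rcons c a) => c'.
have evmon : mpoly_term_eval (c0 ++ rcons c a ++ c') mon = 'X_[m].
  rewrite mpolyXE_id -big_enum /= /mon; elim: (enum _) => [|i s IH] /=.
    by rewrite big_nil /mpoly_term_eval /=.
  rewrite big_cons -IH; congr (_ ^+ _ * _); exact: mpoly_env_var.
rewrite -mul_mpolyC -evmon -[in RHS](tp (a :: c')) -cat_rcons.
congr (_ * _ + _); rewrite /= mpoly_env_const.
by rewrite cat_rcons catA nth_cat ltnn subnn.
Qed.

End MpolyTerm.
Arguments mpoly_env {n R} c.
Arguments mpoly_term_eval {n R} c t.

Lemma mpoly_rat_countable N : exists (f : {mpoly rat[N]} -> nat) g, pcancel f g.
Proof.
exists (fun p => pickle [seq (m, p@_m) | m <- msupp p]).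
exists (fun k => omap (fun s : seq ('X_{1..N} * rat) =>
                    \sum_(c <- s) c.2 *: 'X_[c.1]) (unpickle k)).
by move=> p; rewrite pickleK /= big_map -mpolyE.
Qed.

Section Nullstellensatz.
Variables (R : rcfType) (n : nat).
Local Notation A := {mpoly R[n]}.

(** Nonnegative elements of [R] are squares, hence lie in [T]. A negative [v] in [T] would give -1
    as the product of [v] and the positive constant [- v^-1]. *)
Lemma prime_cone_const (T : set A) (v : R) : prime_cone T ->
  T v%:MP <-> 0 <= v.
Proof.
move=> [[TD TM TX] TN1 Ttot _].
have pos (a : R) : 0 <= a -> T a%:MP.
  by move=> a0; rewrite -(sqr_sqrtr a0) expr2 mpolyCM; exact: TX.
split=> [Tv|/pos //]; rewrite leNgt; apply/negP => v0; apply: TN1.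
rewrite -mpolyC1 -mpolyCN (_ : -1 = v * - v^-1); last first.
  by rewrite mulrN divff // lt_eqF.
by rewrite mpolyCM; apply: TM => //; apply: pos; rewrite oppr_ge0 invr_le0 ltW.
Qed.

(* An ordering of a residue ring of [R[X]] in which [p = 0] and [q != 0] is
   restricted to the countable subring generated over the rationals by the
   indeterminates and the coefficients of [p] and [q]; the corresponding
   point, with coordinates in a real closed extension of that ordered ring, is
   transferred to [R]. *)
Lemma prime_cone_real_point (T : set A) (p q : A) :
    prime_cone T -> support T p -> ~ support T q ->
  exists x : 'I_n -> R, p.@[x] = 0 /\ q.@[x] != 0.
Proof.
move=> cT sp sq.
have [tp [cp tpP]] := mpoly_termP [::] p.
have [tq [cq tqP]] := mpoly_termP cp q.
pose c := cp ++ cq.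
have {}tpP : mpoly_term_eval c tp = p by exact: tpP.
have {}tqP : mpoly_term_eval c tq = q by have := tqP [::]; rewrite cats0.
pose N := (n + size c)%N; pose B := {mpoly rat[N]}.
pose hA : {rmorphism rat -> A} := @mpolyC n R \o ratr.
(* The image of [phi] is the subring generated by the indeterminates and the coefficients of [p] and
   [q]; the ordering is pulled back to the countable ring [B]. *)
pose phi : {rmorphism B -> A} := mmap hA (fun i : 'I_N => (mpoly_env c)`_i).
pose eB : seq B := [seq 'X_i | i : 'I_N].
have eBE : map phi eB = mpoly_env c.
  apply: (@eq_from_nth _ 0).
    by rewrite /eB /mpoly_env size_cat !size_map -!enumT !size_enum_ord.
  move=> i; rewrite /eB !size_map -enumT size_enum_ord => lti.
  rewrite -map_comp (nth_map (Ordinal lti)) ?size_enum_ord //=.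
  by rewrite mmapX mmap1U /= nth_enum_ord.
pose TB : set B := [set b | T (phi b)].
have cTB : prime_cone TB.
  have [[TD TM TX] TN1 Ttot Tprime] := cT; split; first split.
  - by move=> x y; rewrite /TB /= rmorphD; exact: TD.
  - by move=> x y; rewrite /TB /= rmorphM; exact: TM.
  - by move=> x; rewrite /TB /= rmorphM; exact: TX.
  - by rewrite /TB /= rmorphN1.
  - by move=> x; rewrite /TB /= rmorphN; exact: Ttot.
  - move=> x y; have := Tprime (phi x) (phi y).
    by rewrite /support /TB /= -rmorphM -!rmorphN.
have [f [g fK]] := mpoly_rat_countable N.
have [K [j jT]] := prime_cone_rcf fK cTB.
have suppB b : support T (phi b) <-> j b = 0.
  split=> [[Tb TNb]|jb0].
    apply/eqP; rewrite eq_le -oppr_ge0 -rmorphN; apply/andP.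
    by split; apply/jT; rewrite /TB /= ?rmorphN.
  by split; [apply/jT|rewrite -rmorphN; apply/jT]; rewrite ?rmorphN jb0 ?oppr0.
have hAB : phi \o @mpolyC N rat =1 hA by move=> r; rewrite /= mmapC.
have hK : j \o @mpolyC N rat =1 ratr.
  exact: (fmorph_eq_rat (j \o @mpolyC N rat : {rmorphism rat -> K})).
pose evB t := term_eval (@mpolyC N rat) eB t.
have evBp t : phi (evB t) = mpoly_term_eval c t.
  by rewrite rmorph_term_eval eBE; exact: eq_term_eval.
have jconst b (v : R) : phi b = v%:MP -> (0 <= j b) = (0 <= v).
  move=> e; apply/idP/idP => [/jT|/(prime_cone_const v cT) Tv].
    by rewrite /TB /= e => /(prime_cone_const v cT).
  by apply/jT; rewrite /TB /= e.
(* Setting the indeterminates to 0 leaves only the coefficients, in [R] for [zc] and in [K] for the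
   image of [eB0]. Rational terms have the same signs at both, because [T] orders constants as [R]
   does. *)
pose zc := nseq n (0 : R) ++ c.
pose eB0 := nseq n (0 : B) ++ drop n eB.
have signE t : sgz (term_eval ratr (map j eB0) t) = sgz (term_eval ratr zc t).
  have -> : term_eval ratr (map j eB0) t = j (term_eval (@mpolyC N rat) eB0 t).
    by rewrite rmorph_term_eval; exact: eq_term_eval.
  set b := term_eval _ eB0 t; set v := term_eval _ zc t.
  have phib : phi b = v%:MP.
    rewrite /b /v !rmorph_term_eval; apply: eq_term_eval => [//|i].
    rewrite map_cat [in RHS]map_cat map_drop eBE !map_nseq !rmorph0 /mpoly_env.
    by rewrite drop_size_cat // size_map -?enumT size_enum_ord.
  have jle0 : (j b <= 0) = (v <= 0).
    by rewrite -!oppr_ge0 -rmorphN; apply: jconst; rewrite rmorphN phib mpolyCN.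
  by case: (sgzP v) (jconst _ _ phib) jle0; case: (sgzP (j b)).
(* The images in [K] of the indeterminates form the point to transfer; the coefficient variables
   stay fixed. *)
have [i lei|e2 e2P] := @sign_transfer _ _ _ _ signE n (map j eB) [:: tp; tq].
  rewrite map_cat map_drop nth_cat size_map size_nseq ltnNge lei /=.
  by rewrite nth_drop subnKC.
have evx t : term_eval ratr e2 t = (mpoly_term_eval c t).@[fun i : 'I_n => e2`_i].
  rewrite rmorph_term_eval; apply: eq_term_eval => [r|i] /=.
    by rewrite mevalC.
  rewrite nth_map_additive; have [lti|lei] := ltnP i n.
    by have /= -> := mpoly_env_var c (Ordinal lti); rewrite mevalXU.
  rewrite -(subnKC lei) mpoly_env_const /= mevalC e2P ?leq_addr //.
  by rewrite nth_cat size_nseq ltnNge leq_addr /= addnC addnK.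
move=> [ep eq]; exists (fun i : 'I_n => e2`_i); rewrite -[p]tpP -[q]tqP -!evx.
have evj t : term_eval ratr (map j eB) t = j (evB t).
  by rewrite rmorph_term_eval; exact: eq_term_eval.
split.
  apply/eqP; rewrite -sgz_eq0 -ep sgz_eq0 evj; apply/eqP/suppB.
  by rewrite evBp tpP.
rewrite -sgz_eq0 -eq sgz_eq0 evj; apply/eqP => /suppB.
by rewrite evBp tqP.
Qed.

(** The absence of such an identity is the hypothesis under which [prime_cone_above] finds an
    ordering with [p] in its support and [q] outside it. *)
Theorem real_nullstellensatz (p q : A) :
    (forall x : 'I_n -> R, p.@[x] = 0 -> q.@[x] = 0) ->
  exists m s h, wsos [set 1] s /\ - (q ^+ m) ^+ 2 = s + h * p.
Proof.
move=> pq; apply: contrapT => nex.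
have [||T [subT cT sq]] := @prime_cone_above A
    [set x | exists s h, wsos [set 1] s /\ x = s + h * p] q.
- by apply: precone_wsos => // _ _ -> ->; rewrite /= mulr1.
- by move=> m [s [h [ss e]]]; apply: nex; exists m, s, h.
have sp : support T p.
  split; apply: subT.
    by exists 0, 1; split; [exact: Wsos0|rewrite add0r mul1r].
  by exists 0, (- 1); split; [exact: Wsos0|rewrite add0r mulN1r].
have [x [px qx]] := prime_cone_real_point cT sp sq.
by move: qx; rewrite pq ?eqxx.
Qed.

End Nullstellensatz.

(** * Positive definite functionals *)

Section PositiveFunctional.
Variables (R : rcfType) (n : nat) (l : {scalar {mpoly R[n]}}).
Hypothesis l_sqr_ge0 : forall a, 0 <= l (a ^+ 2).
Implicit Types a b p q : {mpoly R[n]}.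

(** The degenerate case of Cauchy-Schwarz: [l ((t *: a + b) ^+ 2)] is affine in [t], and a
    nonnegative affine function has slope zero. *)
Lemma scalar_sqr_eq0 a b : l (a ^+ 2) = 0 -> l (b * a) = 0.
Proof.
move=> la0; apply/eqP/negPn/negP => lba0.
(* This value of [t] makes the affine function equal to -1. *)
pose t := - (l (b ^+ 2) + 1) / (2 * l (b * a)).
have := l_sqr_ge0 (t *: a + b).
rewrite (_ : _ ^+ 2 =
    (t ^+ 2) *: a ^+ 2 + ((2 * t) *: (b * a) + b ^+ 2)); last first.
  by rewrite -!mul_mpolyC; ring.
rewrite !linearD !linearZ /= la0.
rewrite (_ : t ^+ 2 * 0 + _ = -1); first by lra.
by rewrite /t; field.
Qed.

Lemma psd_vanishing p q : (forall x : 'I_n -> R, p.@[x] = 0 -> q.@[x] = 0) ->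
  (forall h, l (h * p) = 0) -> forall h, l (h * q) = 0.
Proof.
move=> pq lp; have [m [s [h [ss e]]]] := real_nullstellensatz pq.
have ls : 0 <= l s.
  move: ss {e}; elim=> [|{}s _ f _ IH ->]; first by rewrite linear0.
  by rewrite linearD mul1r addr_ge0.
have nullexp k : l ((q ^+ k) ^+ 2) = 0 -> forall b, l (b * q ^+ k) = 0.
  by move=> qk0 b; exact: scalar_sqr_eq0.
have ex : exists k, `[< forall b, l (b * q ^+ k) = 0 >].
  exists m; apply/asboolP/nullexp/eqP; rewrite eq_le l_sqr_ge0 andbT.
  by rewrite -oppr_ge0 -linearN e linearD lp addr0.
(* The least exponent is at most 1. From [k.+2] it would drop to [k.+1], as the square of
   [q ^+ k.+1] is [q ^+ k] times [q ^+ k.+2]; exponent 0 means that [l] vanishes identically. *)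
have [[|[|k]] /asboolP lk mink] := ex_minnP ex.
- by move=> b; rewrite -[b * q]mulr1; exact: lk.
- exact: lk.
- suff /mink : `[< forall b, l (b * q ^+ k.+1) = 0 >] by rewrite ltnn.
  apply/asboolP/nullexp.
  by rewrite expr2 {2}exprS mulrA -exprSr mulrC lk.
Qed.

End PositiveFunctional.

(** * Real and imaginary parts of complex polynomials and functionals *)

Section ComplexPolynomials.
Variables (R : realType) (n : nat).
Local Notation C := R[i]%C.
Local Notation ii := ('i%C : C).

Local Notation cpx := (map_mpoly (real_complex R) : {mpoly R[n]} -> {mpoly C[n]}).

Lemma mpoly_complexE (P : {mpoly C[n]}) : exists a b, P = cpx a + ii *: cpx b.
Proof.
elim/mpolyind: P => [|c m P _ _ [a [b ->]]].
  by exists 0, 0; rewrite !rmorph0 scaler0 addr0.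
exists (complex.Re c *: 'X_[m] + a), (complex.Im c *: 'X_[m] + b).
rewrite !rmorphD /= !map_mpolyZ !map_mpolyX {1}[c]complexE scalerDl -scalerA.
by rewrite scalerDr !addrA; congr (_ + _); rewrite addrAC.
Qed.

Lemma mpoly_star_complexE a b :
  mpoly_star (cpx a + ii *: cpx b) = cpx a - ii *: cpx b.
Proof.
have starD (S T : {mpoly C[n]}) : mpoly_star (S + T) = mpoly_star S + mpoly_star T.
  by rewrite /mpoly_star rmorphD.
have starZ z (S : {mpoly C[n]}) : mpoly_star (z *: S) = conjc z *: mpoly_star S.
  by rewrite /mpoly_star map_mpolyZ.
have starX (m : 'X_{1..n}) : mpoly_star 'X_[C, m] = 'X_[m].
  by rewrite /mpoly_star map_mpolyX.
have conj_real (u : R) : conjc (real_complex R u) = real_complex R u.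
  by rewrite conjc_real.
have conj_i : conjc ii = - ii by apply/eqP; rewrite eq_complex /= oppr0 !eqxx.
have star_cpx c : mpoly_star (cpx c) = cpx c.
  elim/mpolyind: c => [|c m p _ _ IH]; first by rewrite /mpoly_star !rmorph0.
  rewrite rmorphD /= map_mpolyZ map_mpolyX starD starZ starX IH conj_real.
  by [].
by rewrite starD (star_cpx a) (starZ ii (cpx b)) (star_cpx b) conj_i scaleNr.
Qed.

Lemma evalR_complexE a b x :
  evalR (cpx a + ii *: cpx b) x =
  (a.@[fun k => x ord0 k] +i* b.@[fun k => x ord0 k])%C.
Proof.
have ev c : (cpx c).@[fun k => (x ord0 k)%:C%C] = (c.@[fun k => x ord0 k])%:C%C.
  elim/mpolyind: c => [|c m P _ _ IH]; first by rewrite !rmorph0.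
  rewrite rmorphD /= map_mpolyZ map_mpolyX !mevalD !mevalZ !mevalX IH.
  rewrite rmorphD rmorphM rmorph_prod; congr (_ * _ + _).
  by apply: eq_bigr => k _; rewrite rmorphXn.
rewrite /evalR mevalD (ev a) (mevalZ _ ii (cpx b)) (ev b); apply/eqP.
by rewrite eq_complex /= !mul0r !mul1r subr0 !addr0 !add0r !eqxx.
Qed.

Lemma evalR_complex_eq0 a b x :
  evalR (cpx a + ii *: cpx b) x = 0 <->
  (a ^+ 2 + b ^+ 2).@[fun k => x ord0 k] = 0.
Proof.
rewrite evalR_complexE mevalD !rmorphXn /=; split=> [[-> ->]|/eqP].
  by rewrite expr0n addr0.
by rewrite paddr_eq0 ?sqr_ge0 // !sqrf_eq0 => /andP[/eqP -> /eqP ->].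
Qed.

Section Functional.
Variable L : {scalar {mpoly C[n]}}.
Hypothesis L_pos : positive_definite L.

Let l (a : {mpoly R[n]}) : R := complex.Re (L (cpx a)).

Lemma functionalZ z (U : {mpoly C[n]}) : L (z *: U) = z * L U.
Proof. by rewrite linearZ. Qed.

(** The combination is the shape of the expansion of [(s + ii *: t) * (c + ii *: d)]. *)
Lemma functional_comb0 (U V W X : {mpoly C[n]}) :
  L U = 0 -> L V = 0 -> L W = 0 -> L X = 0 -> L (U + ii *: V + ii *: W - X) = 0.
Proof.
move=> U0 V0 W0 X0; rewrite linearB !linearD !functionalZ U0 V0 W0 X0.
by rewrite !mulr0 !addr0 subr0.
Qed.

Lemma positive_cpx_sqr a : 0 <= L (cpx (a ^+ 2)).
Proof.
have := L_pos (cpx a).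
have := mpoly_star_complexE a 0.
by rewrite rmorph0 scaler0 addr0 subr0 => ->; rewrite rmorphXn expr2.
Qed.

Lemma cpxB (a b : {mpoly R[n]}) : cpx (a - b) = cpx a - cpx b.
Proof. by rewrite rmorphB. Qed.

Lemma complex_Im_sub0 (x y : C) :
  complex.Im x = 0 -> complex.Im y = 0 -> complex.Im (x - y) = 0.
Proof. by case: x y => [u v] [u' v'] /= -> ->; rewrite subrr. Qed.

(** Positivity makes [L] real on squares of real polynomials, and [4 a] is the difference of the
    squares of [a + 1] and [a - 1]. *)
Lemma positive_cpxE a : L (cpx a) = (l a)%:C%C.
Proof.
have im b : complex.Im (L (cpx (b ^+ 2))) = 0 by exact/ger0_Im/positive_cpx_sqr.
have : complex.Im (L (cpx (4%:R *: a))) = 0.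
  rewrite (_ : _ *: _ = (a + 1) ^+ 2 - (a - 1) ^+ 2); last first.
    by rewrite -mul_mpolyC mpolyC_nat; ring.
  rewrite (cpxB ((a + 1) ^+ 2)) (linearB L).
  by apply: complex_Im_sub0; exact: im.
rewrite map_mpolyZ functionalZ /l; case: (L _) => u v /= /eqP.
rewrite mul0r addr0 mulf_eq0 pnatr_eq0 /= => /eqP ->.
by [].
Qed.

Lemma complex_Re_linear (c : R) (x y : C) :
  complex.Re (c%:C%C * x + y) = c * complex.Re x + complex.Re y.
Proof. by case: x y => [u v] [u' v'] /=; rewrite mul0r subr0. Qed.

Lemma real_part_is_scalar : scalar l.
Proof.
move=> c a b; rewrite /l rmorphD /= map_mpolyZ (linearD L) functionalZ.
exact: complex_Re_linear.
Qed.

Lemma cpxM (a b : {mpoly R[n]}) : cpx (a * b) = cpx a * cpx b.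
Proof. by rewrite rmorphM. Qed.

Lemma cpxD (a b : {mpoly R[n]}) : cpx (a + b) = cpx a + cpx b.
Proof. by rewrite rmorphD. Qed.

Lemma mpoly_mulii (U V : {mpoly C[n]}) : (ii *: U) * (ii *: V) = - (U * V).
Proof.
rewrite -scalerAl -scalerAr scalerA (_ : ii * ii = -1) ?scaleN1r //.
by rewrite -expr2 sqr_i.
Qed.

(** This places the real polynomial [a ^+ 2 + b ^+ 2] in the complex ideal generated by
    [cpx a + ii *: cpx b]. *)
Lemma cpx_normE a b :
  cpx (a ^+ 2 + b ^+ 2) = (cpx a - ii *: cpx b) * (cpx a + ii *: cpx b).
Proof.
rewrite cpxD !expr2 (cpxM a a) (cpxM b b).
move: (cpx a) (cpx b) => U V.
rewrite mulrDl !mulrDr !mulNr mpoly_mulii opprK -scalerAl -scalerAr.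
by rewrite [V * U]mulrC addrA addrK.
Qed.

Let l' : {scalar {mpoly R[n]}} :=
  HB.pack l (GRing.isLinear.Build R {mpoly R[n]} R *%R l real_part_is_scalar).

Lemma positive_vanishing (P Q : {mpoly C[n]}) :
    real_zeros P = real_zeros Q -> (forall S, principal_ideal P S -> L S = 0) ->
  forall S, principal_ideal Q S -> L S = 0.
Proof.
move=> PQ LP _ [S _ <-].
have [a [b eP]] := mpoly_complexE P; have [c [d eQ]] := mpoly_complexE Q.
have [s [t eS]] := mpoly_complexE S.
have l'_sqr e : 0 <= l' (e ^+ 2).
  by have := positive_cpx_sqr e; rewrite positive_cpxE ler0c.
have pq (x : 'I_n -> R) : (a ^+ 2 + b ^+ 2).@[x] = 0 -> (c ^+ 2 + d ^+ 2).@[x] = 0.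
  have <- : (fun k => (\row_j x j) ord0 k) = x by apply/funext => k; rewrite mxE.
  move=> /evalR_complex_eq0; rewrite -eP => Px; apply/evalR_complex_eq0.
  rewrite -eQ; have : real_zeros P (\row_j x j) by [].
  by rewrite PQ.
have l'p h : l' (h * (a ^+ 2 + b ^+ 2)) = 0.
  rewrite /l' /= /l cpxM cpx_normE mulrA -eP LP //.
  by eexists.
have l'q := psd_vanishing l'_sqr pq l'p.
(* Two nonnegative numbers with sum zero both vanish. This passes from the squared modulus of [Q] to
   its real and imaginary parts, and so to [Q] itself. *)
have [c0 d0] : l' (c ^+ 2) = 0 /\ l' (d ^+ 2) = 0.
  have /eqP := l'q 1; rewrite mul1r (linearD l') paddr_eq0 //.
  by move=> /andP[/eqP c0 /eqP d0]; exact: conj c0 d0.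
have Lc h : L (cpx (h * c)) = 0.
  by rewrite positive_cpxE (scalar_sqr_eq0 l'_sqr h c0 : l (h * c) = 0).
have Ld h : L (cpx (h * d)) = 0.
  by rewrite positive_cpxE (scalar_sqr_eq0 l'_sqr h d0 : l (h * d) = 0).
have -> : S * Q = cpx (s * c) + ii *: cpx (s * d) + ii *: cpx (t * c) - cpx (t * d).
  rewrite eS eQ !cpxM; move: (cpx s) (cpx t) (cpx c) (cpx d) => s' t' c' d'.
  by rewrite mulrDl !mulrDr mpoly_mulii -!scalerAl -!scalerAr addrA.
apply: functional_comb0; [exact: Lc|exact: Ld|exact: Lc|exact: Ld].
Qed.

End Functional.

End ComplexPolynomials.

Theorem theorem4p4 (R : realType) (n : nat) (hn : (1 <= n)%N)
  (P Q : {mpoly R[i][n]}) (hZ : real_zeros P = real_zeros Q) :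
  type_A P <-> type_A Q.
Proof.
split=> [tA|tA] L Lpos LI; apply: (tA L Lpos).
- exact: (positive_vanishing Lpos (esym hZ) LI).
- exact: (positive_vanishing Lpos hZ LI).
Qed.
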